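(* Let $a<b$ and $N\ge1$ be integers, $\mathbf{I}=\{a,\dots,b\}$, $\mathbf{J}=\{0,\dots,N\}$ and $\beta>0$. Let $z_1,\dots,z_n$ be edges of the box $\mathbf{I}\times\mathbf{J}$, and for each $i=1,\dots,n$ let $\psi^{(i)}$ be either $\psi$ or $\bar\psi$. Then $$\left\langle\psi^{(1)}(z_1)\cdots\psi^{(n)}(z_n)\right\rangle^+_{\mathbf{I}\times\mathbf{J}}=\mathrm{Pf}(A),$$ where $A$ is the antisymmetric $n\times n$ matrix with entries $A_{ij}=\left\langle\psi^{(i)}(z_i)\psi^{(j)}(z_j)\right\rangle^+_{\mathbf{I}\times\mathbf{J}}$ for $i<j$.
   Context: **Lattice.** Edges are identified with midpoints in $\mathbb{C}$: horizontal edges $\mathbf{I}^*\times\mathbf{J}$, vertical edges $\mathbf{I}\times\mathbf{J}^*$, faces $\mathbf{I}^*\times\mathbf{J}^*$, where $\mathbf{I}^*=\{a+\frac12,\dots,b-\frac12\}$, $\mathbf{J}^*=\{\frac12,\dots,N-\frac12\}$. $\lambda=e^{i\pi/4}$, $\nu=\lambda^{-3}\frac{e^{-2\beta}+i}{e^{-2\beta}-i}$. **Operators.** $\mathcal{S}$ has basis $(\mathbf{e}_\sigma)_{\sigma\in\{\pm1\}^{\mathbf{I}}}$. $V=(V^{h})^{1/2}V^{v}(V^{h})^{1/2}$, where $V^v_{\sigma\rho}=\exp(\beta\sum_{i\in\mathbf{I}}\sigma_i\rho_i)$ if $\sigma_a=\rho_a$ and $\sigma_b=\rho_b$, and $0$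 otherwise; $(V^h)^{1/2}$ is diagonal with entries $\exp(\frac{\beta}{2}\sum_{i=a}^{b-1}\sigma_i\sigma_{i+1})$. For $k\in\mathbf{I}^*$: $p_k(\mathbf{e}_\sigma)=\sigma_{k+1/2}\mathbf{e}_\tau$, $q_k(\mathbf{e}_\sigma)=i\sigma_{k-1/2}\mathbf{e}_\tau$ with $\tau_x=\sigma_x$ for $x>k$, $\tau_x=-\sigma_x$ for $x<k$. $\psi_k=\frac{i}{\sqrt2}(p_k+q_k)$, $\bar\psi_k=\frac1{\sqrt2}(p_k-q_k)$; $\psi(k+iy)=V^{-y}\psi_kV^y$, $\bar\psi(k+iy)=V^{-y}\bar\psi_kV^y$ for $k+iy\in\mathbf{I}^*\times\mathbf{J}$. On vertical edges, $\psi,\bar\psi$ denote the unique operator-valued extension such that, for each face with center $c$ and edges $E=c+\frac12$, $N=c+\frac i2$, $W=c-\frac12$, $S=c-\frac i2$: $\psi(N)+\nu^{-1}\lambda\bar\psi(N)=\nu^{-1}\psi(E)+\lambda\bar\psi(E)$, $\psi(N)+\nu\lambda^{-1}\bar\psi(N)=\nu\psi(W)+\lambda^{-1}\bar\psi(W)$, $\psi(S)+\nu\lambda^{3}\bar\psi(S)=\nu\psi(E)+\lambda^{3}\bar\psi(E)$, $\psi(S)+\nu^{-1}\lambda^{-3}\bar\psi(S)=\nu^{-1}\psi(W)+\lambda^{-3}\bar\psi(W)$, and $\psi(a+iy)+i\bar\psi(a+iy)=0$, $\psi(b+iy)-i\bar\psi(b+iy)=0$ for $y\in\mathbf{J}^*$.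 (These values lie in $\mathrm{span}_{\mathbb{C}}\{p_k,q_k\}$.) **Correlations.** $\mathbf{e}_{(+)}$ is the basis vector of the all-plus configuration, and, with the operator product taken in the order written, $\langle\psi^{(1)}(z_1)\cdots\psi^{(n)}(z_n)\rangle^+_{\mathbf{I}\times\mathbf{J}}=\frac{\mathbf{e}_{(+)}^\top V^N\psi^{(1)}(z_1)\cdots\psi^{(n)}(z_n)\mathbf{e}_{(+)}}{\mathbf{e}_{(+)}^\top V^N\mathbf{e}_{(+)}}$. **Pfaffian.** For antisymmetric $A\in\mathbb{C}^{n\times n}$: $\mathrm{Pf}(A)=0$ for $n$ odd, and for $n=2m$, $\mathrm{Pf}(A)=\frac1{2^mm!}\sum_{\pi\in S_{2m}}\mathrm{sgn}(\pi)\prod_{s=1}^mA_{\pi(2s-1),\pi(2s)}$. *)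

(* Defs.v *)
From mathcomp Require Import all_boot all_order all_fingroup all_algebra.
From mathcomp Require Import complex.
From mathcomp Require Import reals sequences exp trigo.

Set Implicit Arguments.
Unset Strict Implicit.
Unset Printing Implicit Defensive.
Import Order.TTheory GRing.Theory Num.Theory.
Local Open Scope ring_scope.
Local Open Scope complex_scope.

Section Lattice.
Variables (R : realType) (a b : int) (N : nat).

(* Number of columns of faces. The site a + j of I is indexed by j : 'I_width.+1
   and the half-integer a + j + 1/2 of I^* by j : 'I_width, since a < b. *)
Definition width : nat := `|b - a|%N.

Definition horizontal_edge (j : 'I_width) (y : 'I_N.+1) : R[i] :=
  ((a + j%:Z)%:~R + 2^-1) +i* y%:R.

Definition vertical_edge (j : 'I_width.+1) (y : 'I_N) : R[i] :=
  (a + j%:Z)%:~R +i* (y%:R + 2^-1).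

Definition face (j : 'I_width) (y : 'I_N) : R[i] :=
  ((a + j%:Z)%:~R + 2^-1) +i* (y%:R + 2^-1).

Definition is_edge (z : R[i]) : Prop :=
  (exists (j : 'I_width) (y : 'I_N.+1), z = horizontal_edge j y) \/
  (exists (j : 'I_width.+1) (y : 'I_N), z = vertical_edge j y).

Definition lsite (j : 'I_width) : 'I_width.+1 := widen_ord (leqnSn width) j.
Definition rsite (j : 'I_width) : 'I_width.+1 := lift ord0 j.

(* Configurations: true stands for +1 and false for -1. *)
Definition conf : finType := {ffun 'I_width.+1 -> bool}.

Definition spin (K : pzRingType) (sigma : conf) (j : 'I_width.+1) : K :=
  if sigma j then 1 else -1.

Definition all_plus : conf := [ffun=> true].

(* The configuration tau of p_k, q_k for k = a + j + 1/2: the spins at the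
   sites x < k, that is x = a + i with i <= j, are reversed. *)
Definition flip_left (j : 'I_width) (sigma : conf) : conf :=
  [ffun i : 'I_width.+1 => if (i <= j)%N then ~~ sigma i else sigma i].

(* Operators on the space with basis (e_sigma) are matrices acting on column
   vectors, rows and columns being indexed through the enumeration of conf. *)
Definition operator : Type := 'M[R[i]]_#|{: conf}|.

Definition operator_of (F : conf -> conf -> R[i]) : operator :=
  \matrix_(r, c) F (enum_val r) (enum_val c).

Definition basis_vector (sigma : conf) : 'cV[R[i]]_#|{: conf}| :=
  delta_mx (enum_rank sigma) 0.

Section Operators.
Variable beta : R.

Definition Vv : operator := operator_of (fun sigma rho =>
  if (sigma ord0 == rho ord0) && (sigma ord_max == rho ord_max)
  then (expR (beta * \sum_i spin R sigma i * spin R rho i))%:C else 0).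

Definition Vh_half : operator := operator_of (fun sigma rho =>
  if sigma == rho
  then (expR (beta / 2 *
          \sum_j spin R sigma (lsite j) * spin R sigma (rsite j)))%:C
  else 0).

Definition V : operator := Vh_half *m Vv *m Vh_half.

Definition Vpow (y : nat) : operator := (V : 'M__) ^+ y.

Definition p (j : 'I_width) : operator := operator_of (fun tau sigma =>
  if tau == flip_left j sigma then spin _ sigma (rsite j) else 0).

Definition q (j : 'I_width) : operator := operator_of (fun tau sigma =>
  if tau == flip_left j sigma then 'i * spin _ sigma (lsite j) else 0).

Definition sqrt2 : R[i] := (Num.sqrt 2)%:C.

Definition psi0 (j : 'I_width) : operator := ('i / sqrt2) *: (p j + q j).
Definition psibar0 (j : 'I_width) : operator := sqrt2^-1 *: (p j - q j).

(* exp (i pi / 4) *)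
Definition lambda : R[i] := cos (pi / 4) +i* sin (pi / 4).

Definition nu : R[i] :=
  lambda ^- 3 * (((expR (- 2 * beta))%:C + 'i) / ((expR (- 2 * beta))%:C - 'i)).

(* psi, psibar are functions of the midpoint of the edge; only their values at
   the edges of the box matter. The conditions determine these values. *)
Record is_fermion (psi psibar : R[i] -> operator) : Prop := IsFermion {
  psi_horizontal : forall j y,
    psi (horizontal_edge j y) = invmx (Vpow y) *m psi0 j *m Vpow y;
  psibar_horizontal : forall j y,
    psibar (horizontal_edge j y) = invmx (Vpow y) *m psibar0 j *m Vpow y;
  face_NE : forall j y, let c := face j y in
    psi (c + 'i / 2) + (nu^-1 * lambda) *: psibar (c + 'i / 2)
    = nu^-1 *: psi (c + 1 / 2) + lambda *: psibar (c + 1 / 2);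
  face_NW : forall j y, let c := face j y in
    psi (c + 'i / 2) + (nu * lambda^-1) *: psibar (c + 'i / 2)
    = nu *: psi (c - 1 / 2) + lambda^-1 *: psibar (c - 1 / 2);
  face_SE : forall j y, let c := face j y in
    psi (c - 'i / 2) + (nu * lambda ^+ 3) *: psibar (c - 'i / 2)
    = nu *: psi (c + 1 / 2) + lambda ^+ 3 *: psibar (c + 1 / 2);
  face_SW : forall j y, let c := face j y in
    psi (c - 'i / 2) + (nu^-1 * lambda ^- 3) *: psibar (c - 'i / 2)
    = nu^-1 *: psi (c - 1 / 2) + lambda ^- 3 *: psibar (c - 1 / 2);
  left_boundary : forall y : 'I_N, let z := a%:~R +i* (y%:R + 2^-1) in
    psi z + 'i *: psibar z = 0;
  right_boundary : forall y : 'I_N, let z := b%:~R +i* (y%:R + 2^-1) in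
    psi z - 'i *: psibar z = 0
}.

Definition expectation (M : operator) : R[i] :=
  let e := basis_vector all_plus in
  (e^T *m Vpow N *m M *m e) 0 0 / (e^T *m Vpow N *m e) 0 0.

End Operators.
End Lattice.

Lemma pf_index_lt (n : nat) (s : 'I_n./2) : (s.*2.+1 < n)%N.
Proof.
by rewrite -[ltnRHS]odd_double_half -doubleS (leq_trans _ (leq_addl _ _)) ?leq_double.
Qed.

Definition pf_fst (n : nat) (s : 'I_n./2) : 'I_n := Ordinal (ltnW (pf_index_lt s)).
Definition pf_snd (n : nat) (s : 'I_n./2) : 'I_n := Ordinal (pf_index_lt s).

(* With 0-based indices, pi(2s-1), pi(2s) for 1 <= s <= n/2 read pi(2s),
   pi(2s+1) for 0 <= s < n/2. *)
Definition Pf (K : fieldType) (n : nat) (A : 'M[K]_n) : K :=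
  if odd n then 0 else
  (2 ^+ n./2 * (n./2)`!%:R)^-1 *
  \sum_(s : 'S_n) (-1) ^+ s * \prod_(k < n./2) A (s (pf_fst k)) (s (pf_snd k)).

(* The antisymmetric matrix whose entries above the diagonal are given by F. *)
Definition antisymmetric_mx (K : fieldType) (n : nat) (F : 'I_n -> 'I_n -> K) :
    'M[K]_n :=
  \matrix_(i, j) if (i < j)%N then F i j else if (j < i)%N then - F j i else 0.

(* Main.v *)
Require Import Defs.
From mathcomp Require Import all_boot all_order all_fingroup all_algebra.
From mathcomp Require Import complex ring.
From mathcomp Require Import reals sequences exp trigo.
Import Order.TTheory GRing.Theory Num.Theory.
Local Open Scope ring_scope.
Set Implicit Arguments.
Unset Strict Implicit.
Unset Printing Implicit Defensive.

(* Let W be the span of the operators p_k and q_k. They satisfy the Clifford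
   relations, so the anticommutator of two elements of W is a scalar, and
   conjugation by the transfer matrix V preserves W; solving the face relations
   for their east or west edge then puts psi and psibar in W at every edge.
   Put e = e_(+) and l = e^T V^N. The operators a_j = q_j - i p_j kill e, and
   l W is contained in the span of the row vectors e_tau^T V^N, where tau ranges
   over the configurations obtained from (+) by one left flip. Both families
   have b - a members, and if a combination d of the a_j satisfies l d = 0 then
   <d w> = <w d> = 0 for all w in W, so d anticommutes with W and vanishes.
   Hence every w in W differs from some d in W with d e = 0 by an element killed
   by l on the left. In <w_1 ... w_n> one may therefore replace w_1 by d_1, and
   moving d_1 to the right produces the first-row expansion of the Pfaffian. *)

(** * Expansion of the Pfaffian along the first row *)

Lemma lift_perm_surj n (i j : 'I_n.+1) (s : 'S_n.+1) :
  s i = j -> exists t, lift_perm i j t = s.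
Proof.
move=> sij.
(* The default [k] is never returned: [lift i k] differs from [i], so its image under [s] differs
   from [j]. *)
pose f k := odflt k (unlift j (s (lift i k))).
have fE k : lift j (f k) = s (lift i k).
  rewrite /f; case: unliftP => [k' -> //|/esym eq_j].
  by have := neq_lift i k; rewrite -(inj_eq (@perm_inj _ s)) sij eq_j eqxx.
have f_inj : injective f.
  by move=> k l /(congr1 (lift j)); rewrite !fE => /perm_inj/lift_inj.
exists (perm f_inj); apply/permP=> k.
case: (unliftP i k) => [k'|] ->; first by rewrite lift_perm_lift permE fE.
by rewrite lift_perm_id sij.
Qed.

Lemma lift_perm_inj n (i j : 'I_n.+1) : injective (lift_perm i j).
Proof.
move=> t t' eq_t; apply/permP=> k; apply: (@lift_inj _ j).
by rewrite -!(lift_perm_lift i) eq_t.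
Qed.

Lemma sum_lift_perm (V : nmodType) n (i j : 'I_n.+1) (F : 'S_n.+1 -> V) :
  \sum_(s : 'S_n.+1 | s i == j) F s = \sum_(t : 'S_n) F (lift_perm i j t).
Proof.
have <- : \sum_(s in [set lift_perm i j t | t : 'S_n]) F s
          = \sum_t F (lift_perm i j t).
  by rewrite big_imset; [apply: eq_bigl => t; rewrite inE | move=> t t' _ _ /lift_perm_inj].
apply: eq_bigl => s; apply/eqP/imsetP => [/lift_perm_surj[t <-]|[t _ ->]]; first by exists t.
exact: lift_perm_id.
Qed.

Lemma pf_fst_inj m : injective (@pf_fst m).
Proof. by move=> k l /(congr1 val) /= /double_inj/val_inj. Qed.

Lemma pf_snd_inj m : injective (@pf_snd m).
Proof. by move=> k l /(congr1 val) /= [] /double_inj/val_inj. Qed.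

Lemma pf_fst_neq_snd m (k l : 'I_m./2) : pf_fst k != pf_snd l.
Proof.
by apply/eqP => /(congr1 (odd \o val)); rewrite /= !odd_double.
Qed.

Section Expand.
Variables (K : numFieldType) (n : nat) (A : 'M[K]_n.+2).
Hypothesis A_anti : forall i j, A j i = - A i j.

Let u (s : 'S_n.+2) : K :=
  (-1) ^+ s * \prod_(k < n.+2./2) A (s (pf_fst k)) (s (pf_snd k)).
(* G p does not depend on p: exchanging the entries of a pair changes both the
   signature and one matrix entry by a sign, and permuting pairs changes nothing. *)
Let G p := \sum_(s : 'S_n.+2 | s p == ord0) u s.

Let G_snd k : G (pf_snd k) = G (pf_fst k).
Proof.
rewrite /G (reindex_inj (mulgI (tperm (pf_fst k) (pf_snd k)))) /=.
apply: eq_big => s; first by rewrite permM tpermR.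
move=> _; rewrite /u odd_permM odd_tperm pf_fst_neq_snd.
rewrite (bigD1 k) //= [in RHS](bigD1 k) //= !permM tpermL tpermR.
rewrite [A (s (pf_snd k)) _]A_anti signrN !mulNr mulrN opprK.
congr (_ * (_ * _)); apply: eq_bigr => l nlk.
by rewrite !permM !tpermD ?(inj_eq (@pf_fst_inj _)) ?(inj_eq (@pf_snd_inj _))
   ?pf_fst_neq_snd // 1?eq_sym ?pf_fst_neq_snd // eq_sym.
Qed.

Let G_fst k : G (pf_fst k) = G ord0.
Proof.
have -> : ord0 = pf_fst (ord0 : 'I_n.+2./2) by apply: val_inj.
have [-> //|k0] := eqVneq k (ord0 : 'I_n.+2./2).
set o : 'I_n.+2./2 := ord0.
(* [pi] swaps the whole pairs [o] and [k]; as a product of two transpositions it is even, so no sign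
   appears. *)
pose pi := (tperm (pf_fst o) (pf_fst k) * tperm (pf_snd o) (pf_snd k))%g.
have pi_fst l : pi (pf_fst l) = pf_fst (tperm o k l).
  rewrite permM -(inj_tperm _ _ _ (@pf_fst_inj _)).
  by rewrite tpermD // eq_sym pf_fst_neq_snd.
have pi_snd l : pi (pf_snd l) = pf_snd (tperm o k l).
  rewrite permM (_ : tperm _ _ (pf_snd l) = pf_snd l).
    by rewrite -(inj_tperm _ _ _ (@pf_snd_inj _)).
  by rewrite tpermD ?pf_fst_neq_snd.
rewrite /G [RHS](reindex_inj (mulgI pi)) /=.
apply: eq_big => s; first by rewrite permM pi_fst tpermL.
move=> _; rewrite /u !odd_permM !odd_tperm !(inj_eq (@pf_fst_inj _)).
rewrite !(inj_eq (@pf_snd_inj _)) addbb addFb; congr (_ * _).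
rewrite [LHS](reindex_inj (@perm_inj _ (tperm o k))) /=.
by apply: eq_bigr => l _; rewrite ![(pi * s)%g _]permM pi_fst pi_snd.
Qed.

(** Permutations with [s ord0 = ord0] are sorted by the partner [lift ord0 j] of 0 in the first
    pair. Removing that pair leaves an arbitrary permutation of n indices and changes the signature
    by (-1)^j. *)
Let G0E : G ord0 = \sum_(j < n.+1) (-1) ^+ j * A ord0 (lift ord0 j) *
  \sum_(t : 'S_n) (-1) ^+ t * \prod_(k < n./2)
     A (lift ord0 (lift j (t (pf_fst k)))) (lift ord0 (lift j (t (pf_snd k)))).
Proof.
rewrite /G sum_lift_perm (partition_big (fun t : 'S_n.+1 => t ord0) predT) //=.
apply: eq_bigr => j _; rewrite sum_lift_perm mulr_sumr; apply: eq_bigr => t _.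
rewrite /u !odd_lift_perm /= signr_addb signr_odd mulrACA -!mulrA.
congr (_ * (_ * _)).
rewrite big_ord_recl; congr (_ * _).
  have -> : pf_fst (ord0 : 'I_n.+2./2) = ord0 by apply: val_inj.
  have -> : pf_snd (ord0 : 'I_n.+2./2) = lift ord0 ord0 by apply: val_inj.
  by rewrite lift_perm_lift !lift_perm_id.
apply: eq_bigr => k _.
have -> : pf_fst (lift ord0 k : 'I_n.+2./2) = lift ord0 (lift ord0 (pf_fst k)).
  by apply: val_inj.
have -> : pf_snd (lift ord0 k : 'I_n.+2./2) = lift ord0 (lift ord0 (pf_snd k)).
  by apply: val_inj.
by rewrite !lift_perm_lift.
Qed.

(** Every permutation takes the value 0 at exactly one of the n+2 positions, and each position
    contributes [G ord0]. For even n the factor n+2 = 2(n/2+1) is the ratio of the two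
    normalisations. *)
Lemma Pf_expand : Pf A = \sum_(j < n.+1) (-1) ^+ j * A ord0 (lift ord0 j) *
  Pf (mxsub (lift ord0 \o lift j) (lift ord0 \o lift j) A).
Proof.
rewrite /Pf /= negbK; case: ifPn => n_odd.
  by rewrite big1 // => j _; rewrite mulr0.
have G_const q : G q = G ord0.
  have q_lt : (q./2 < n.+2./2)%N.
    by rewrite ltn_half_double; apply: leq_trans (ltn_ord q) _;
       rewrite -{1}[n.+2]odd_double_half /= negbK (negbTE n_odd).
  have := odd_double_half q; case: (odd q) => /= qE.
    have -> : q = pf_snd (Ordinal q_lt) by apply: val_inj; rewrite /= -{1}qE.
    by rewrite G_snd G_fst.
  have -> : q = pf_fst (Ordinal q_lt) by apply: val_inj; rewrite /= -{1}qE.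
  by rewrite G_fst.
have -> : \sum_s u s = n.+2%:R * G ord0.
  rewrite (partition_big (fun s : 'S_n.+2 => (s^-1)%g ord0) predT) //=.
  rewrite (eq_bigr (fun=> G ord0)) => [|q _].
    by rewrite sumr_const card_ord mulr_natl.
  rewrite -(G_const q); apply: eq_bigl => s.
  by apply/eqP/eqP => [<-|<-]; rewrite ?permKV ?permK.
have nE : n.+2%:R = 2 * (n./2).+1%:R :> K.
  by rewrite -natrM mul2n doubleS -{1}[n]odd_double_half (negbTE n_odd).
rewrite mulrA (_ : _ * n.+2%:R = (2 ^+ n./2 * (n./2)`!%:R)^-1); last first.
  rewrite [in LHS]nE /= exprS factS natrM; field.
  by rewrite nat1r !pnatr_eq0 expf_neq0 ?pnatr_eq0 -?lt0n ?fact_gt0.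
rewrite G0E mulr_sumr.
apply: eq_bigr => j _; rewrite mulrCA; congr (_ * (_ * _)).
by apply: eq_bigr => t _; congr (_ * _); apply: eq_bigr => k _; rewrite mxE.
Qed.

End Expand.

(** * Wick's theorem *)

(** Each passage of [d] across a factor costs a sign and leaves a term in which that factor is
    replaced by a scalar. *)
Lemma anticommute_prod (K : fieldType) D n (d : 'M[K]_D) (w : 'I_n.+1 -> 'M[K]_D)
    (B : 'I_n.+1 -> K) :
  (forall j, d *m w j + w j *m d = (B j)%:M) ->
  d *m \prod_i w i = \sum_(j < n.+1) ((-1) ^+ j * B j) *: \prod_(i < n) w (lift j i)
                     + (-1) ^+ n.+1 *: (\prod_i w i *m d).
Proof.
elim: n w B => [|n IHn] w B dw.
  rewrite !big_ord_recl !big_ord0 /= mulr1 addr0 expr0 mul1r expr1 scaleN1r.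
  by rewrite scalemx1 -dw addrK.
have dw' j := dw (lift ord0 j).
have /(canRL (addrK _)) dw0 := dw ord0.
rewrite big_ord_recl mulmxA dw0 mulmxBl mul_scalar_mx -mulmxA (IHn _ _ dw').
rewrite mulmxDr opprD addrA [X in _ = X + _]big_ord_recl expr0 mul1r; congr (_ + _); last first.
  by rewrite -scalemxAr mulmxA -scaleNr [in RHS]exprS mulN1r.
rewrite [\prod_i w (lift ord0 i)](eq_bigr (fun i => w (lift ord0 i))) //.
congr (_ + _); rewrite -mulmxN -sumrN mulmx_sumr; apply: eq_bigr => j _.
rewrite big_ord_recl -scaleNr -scalemxAr exprS mulN1r mulNr; congr (_ *: (w _ *m _)).
  exact: val_inj.
apply: eq_bigr => i _; congr w; apply: val_inj; rewrite /= /bump /=.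
by rewrite !add1n ltnS; case: leqP => _; rewrite ?add1n ?add0n.
Qed.

Lemma antisymmetric_mx_skew (K : fieldType) n (F : 'I_n -> 'I_n -> K) i j :
  antisymmetric_mx F j i = - antisymmetric_mx F i j.
Proof.
by rewrite !mxE; case: ltngtP => // _; rewrite ?opprK ?oppr0.
Qed.

Lemma lift_ltn n (j : 'I_n.+1) (k l : 'I_n) : (lift j k < lift j l)%N = (k < l)%N.
Proof. by rewrite /= !ltnNge leq_bump2. Qed.

Section Wick.
Variables (K : numFieldType) (D : nat) (l : 'rV[K]_D) (e : 'cV[K]_D).
Hypothesis vac_neq0 : (l *m e) 0 0 != 0.

Definition vev (M : 'M[K]_D) : K := (l *m M *m e) 0 0 / (l *m e) 0 0.

Lemma vevD M M' : vev (M + M') = vev M + vev M'.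
Proof. by rewrite /vev mulmxDr mulmxDl mxE mulrDl. Qed.

Lemma vevZ x M : vev (x *: M) = x * vev M.
Proof. by rewrite /vev -scalemxAr -scalemxAl mxE mulrA. Qed.

Lemma vev_sum I (r : seq I) (P : pred I) (F : I -> 'M_D) :
  vev (\sum_(i <- r | P i) F i) = \sum_(i <- r | P i) vev (F i).
Proof.
apply: (big_morph vev vevD).
by rewrite /vev mulmx0 mul0mx mxE mul0r.
Qed.

Lemma vev_scalar x : vev x%:M = x.
Proof. by rewrite /vev mul_mx_scalar -scalemxAl mxE mulfK. Qed.

Lemma vev_annihilator (M d : 'M[K]_D) : d *m e = 0 -> vev (M *m d) = 0.
Proof. by move=> de0; rewrite /vev mulmxA -mulmxA de0 mulmx0 mxE mul0r. Qed.

Lemma vev_creator (c M : 'M[K]_D) : l *m c = 0 -> vev (c *m M) = 0.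
Proof. by move=> lc0; rewrite /vev mulmxA lc0 !mul0mx mxE mul0r. Qed.

Lemma wick n (w d : 'I_n -> 'M[K]_D) (B : 'I_n -> 'I_n -> K) :
  (forall i, l *m (w i - d i) = 0) -> (forall i, d i *m e = 0) ->
  (forall i j, d i *m w j + w j *m d i = (B i j)%:M) ->
  vev (\prod_i w i) = Pf (antisymmetric_mx (fun i j => vev (w i *m w j))).
Proof.
(* The induction is on a bound for the length, because one expansion step removes two operators. *)
have [m] := ubnP n; elim: m n w d B => // m IHm [|[|n]] w d B n_lt lc de dw.
- rewrite big_ord0 vev_scalar /Pf /= expr0 mul1r invr1 mul1r (big_pred1 1%g).
    by rewrite odd_perm1 big_ord0 mulr1.
  by move=> s; apply/esym/eqP/permP => -[].
- rewrite big_ord1 /Pf /=; rewrite -[w 0](subrK (d 0)) vevD.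
  rewrite -[w 0 - d 0]mulmx1 vev_creator //.
  by have := vev_annihilator 1%:M (de 0); rewrite mul1mx => ->; rewrite addr0.
rewrite Pf_expand; last exact: antisymmetric_mx_skew.
have vev_w0 M : vev (w ord0 *m M) = vev (d ord0 *m M).
  by rewrite -{1}[w ord0](subrK (d ord0)) mulmxDl vevD vev_creator // add0r.
rewrite big_ord_recl vev_w0 (anticommute_prod (fun j => dw ord0 (lift ord0 j))).
rewrite vevD vevZ vev_annihilator // mulr0 addr0 vev_sum.
apply: eq_bigr => j _; rewrite vevZ mxE /=.
(* The scalar is the two-point function itself: [w ord0] may be replaced by [d ord0], and the
   product ending in [d ord0] has zero expectation. *)
have -> : B ord0 (lift ord0 j) = vev (w ord0 *m w (lift ord0 j)).
  rewrite vev_w0; have /(canRL (addrK _)) -> := dw ord0 (lift ord0 j).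
  by rewrite vevD -mulmxN vev_annihilator ?mulNmx ?addr0 ?vev_scalar // de oppr0.
congr (_ * _).
rewrite (IHm n _ (fun i => d (lift ord0 (lift j i)))
  (fun i k => B (lift ord0 (lift j i)) (lift ord0 (lift j k)))) //; last exact: ltnW.
by congr Pf; apply/matrixP => i k; rewrite !mxE !lift_ltn.
Qed.

End Wick.

(** * Operators on configurations *)

Section Operators.
Local Open Scope complex_scope.
Variables (R : realType) (a b : int).
Local Notation C := R[i].
Local Notation sites := 'I_(width a b).+1.
Local Notation cols := 'I_(width a b).
Implicit Types (j k : cols) (sigma tau rho : conf a b).

Lemma eq_operator_of (F G : conf a b -> conf a b -> C) :
  (forall sigma rho, F sigma rho = G sigma rho) -> operator_of F = operator_of G.
Proof. by move=> eFG; apply/matrixP => r c; rewrite !mxE eFG. Qed.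

Lemma operator_ofM (F G : conf a b -> conf a b -> C) :
  operator_of F *m operator_of G =
  operator_of (fun sigma rho => \sum_tau F sigma tau * G tau rho).
Proof.
apply/matrixP => r c; rewrite !mxE (reindex (@enum_rank (conf a b))) /=.
  by apply: eq_bigr => tau _; rewrite !mxE enum_rankK.
exact: onW_bij (enum_rank_bij _).
Qed.

Lemma operator_ofD (F G : conf a b -> conf a b -> C) :
  operator_of F + operator_of G =
  operator_of (fun sigma rho => F sigma rho + G sigma rho).
Proof. by apply/matrixP => r c; rewrite !mxE. Qed.

Lemma operator_ofZ x (F : conf a b -> conf a b -> C) :
  x *: operator_of F = operator_of (fun sigma rho => x * F sigma rho).
Proof. by apply/matrixP => r c; rewrite !mxE. Qed.

Lemma operator_of_tr (F : conf a b -> conf a b -> C) :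
  (operator_of F)^T = operator_of (fun sigma rho => F rho sigma).
Proof. by apply/matrixP => r c; rewrite !mxE. Qed.

Lemma operator_of_scalar (x : C) :
  operator_of (fun sigma rho : conf a b => if sigma == rho then x else 0) = x%:M.
Proof.
apply/matrixP => r c; rewrite !mxE (inj_eq enum_val_inj).
by case: eqP => _; rewrite ?mulr1n ?mulr0n.
Qed.

Lemma operator_of_basis (F : conf a b -> conf a b -> C) sigma :
  operator_of F *m basis_vector R sigma = \sum_tau F tau sigma *: basis_vector R tau.
Proof.
apply/matrixP => r c; rewrite -colE !mxE enum_rankK summxE (bigD1 (enum_val r)) //=.
rewrite !mxE enum_valK eqxx ord1 mulr1 big1 ?addr0 // => tau tau_r.
by rewrite !mxE eqxx andbT -{1}[r]enum_valK (inj_eq enum_rank_inj) eq_sym (negbTE tau_r) mulr0.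
Qed.

Definition sign (s : bool) : C := if s then 1 else -1.

Lemma signN (s : bool) : sign (~~ s) = - sign s.
Proof. by case: s; rewrite /= ?opprK. Qed.

Lemma sign_sqr (s : bool) : sign s * sign s = 1.
Proof. by case: s; rewrite /= ?mulrNN mulr1. Qed.

Lemma flip_leftK j : involutive (flip_left j).
Proof.
by move=> sigma; apply/ffunP => i; rewrite !ffunE; case: ifP => ltij; rewrite ?ltij ?negbK.
Qed.

Lemma flip_left_eq j sigma rho : (flip_left j sigma == rho) = (sigma == flip_left j rho).
Proof. by rewrite -(inj_eq (inv_inj (@flip_leftK j))) flip_leftK. Qed.

Lemma flip_leftC j k sigma : flip_left j (flip_left k sigma) = flip_left k (flip_left j sigma).
Proof. by apply/ffunP => i; rewrite !ffunE; do 2 case: ifP => _. Qed.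

Lemma sign_flip_left j sigma (i : sites) :
  sign (flip_left j sigma i) = (if (i <= j)%N then -1 else 1) * sign (sigma i).
Proof. by rewrite ffunE; case: leqP => _; rewrite ?signN ?mul1r ?mulN1r. Qed.

Definition flip_op j (f : conf a b -> C) : operator R a b :=
  operator_of (fun tau sigma => if tau == flip_left j sigma then f sigma else 0).

Lemma mul_flip_op (F : conf a b -> conf a b -> C) j f :
  operator_of F *m flip_op j f =
  operator_of (fun sigma rho => F sigma (flip_left j rho) * f rho).
Proof.
rewrite operator_ofM; apply: eq_operator_of => sigma rho.
rewrite (bigD1 (flip_left j rho)) //= eqxx big1 ?addr0 // => tau.
by move=> /negbTE ->; rewrite mulr0.
Qed.

Lemma flip_op_mul (F : conf a b -> conf a b -> C) j f :
  flip_op j f *m operator_of F =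
  operator_of (fun sigma rho => f (flip_left j sigma) * F (flip_left j sigma) rho).
Proof.
rewrite operator_ofM; apply: eq_operator_of => sigma rho.
rewrite (bigD1 (flip_left j sigma)) //= flip_leftK eqxx big1 ?addr0 // => tau tau_s.
by rewrite -flip_left_eq eq_sym (negbTE tau_s) mul0r.
Qed.

Lemma flip_op_basis j f sigma :
  flip_op j f *m basis_vector R sigma = f sigma *: basis_vector R (flip_left j sigma).
Proof.
rewrite operator_of_basis (bigD1 (flip_left j sigma)) //= eqxx big1 ?addr0 // => tau.
by move=> /negbTE ->; rewrite scale0r.
Qed.

Lemma pE j : p R j = flip_op j (fun sigma => sign (sigma (rsite j))).
Proof. by []. Qed.

Lemma qE j : q R j = flip_op j (fun sigma => 'i * sign (sigma (lsite j))).
Proof. by []. Qed.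

Lemma tr_p j : (p R j)^T = p R j.
Proof.
rewrite pE operator_of_tr; apply: eq_operator_of => sigma rho.
rewrite eq_sym flip_left_eq; case: eqP => // ->.
by rewrite sign_flip_left /= ltnn mul1r.
Qed.

(** Transposing a weighted flip evaluates its weight after the flip. The flip reverses [lsite j] but
    not [rsite j], so q_j is antisymmetric whereas p_j is symmetric. *)
Lemma tr_q j : (q R j)^T = - q R j.
Proof.
rewrite qE -scaleN1r operator_ofZ operator_of_tr; apply: eq_operator_of => sigma rho.
rewrite eq_sym flip_left_eq; case: eqP => [->|_]; last by rewrite mulr0.
by rewrite sign_flip_left /= leqnn mulrCA.
Qed.

(** Left flips commute, so both products lead to the same configuration and only the weights have to
    be compared. *)
Lemma anticommutator_flip_op j k f g :
  flip_op j f *m flip_op k g + flip_op k g *m flip_op j f =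
  operator_of (fun tau sigma => if tau == flip_left j (flip_left k sigma)
    then f (flip_left k sigma) * g sigma + g (flip_left j sigma) * f sigma else 0).
Proof.
rewrite !mul_flip_op operator_ofD; apply: eq_operator_of => tau sigma.
by rewrite flip_leftC; case: ifP => _; rewrite ?mul0r ?addr0.
Qed.

Lemma sqr_i_mul (x y : C) : ('i * x) * ('i * y) = - (x * y).
Proof. by rewrite mulrACA -expr2 sqrCi mulN1r. Qed.

Lemma anticommutator_pp j k :
  p R j *m p R k + p R k *m p R j = (if j == k then 2 else 0)%:M.
Proof.
rewrite !pE anticommutator_flip_op -operator_of_scalar.
apply: eq_operator_of => tau sigma; rewrite !sign_flip_left /=.
have [<-|neq] := eqVneq j k.
  by rewrite flip_leftK /bump /= ltnn !mul1r sign_sqr -natr1.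
(* For j distinct from k, exactly one of the two flips reverses the right-hand site of the other
   column, so the weights cancel. *)
suff -> : (if (bump 0 j <= k)%N then -1 else 1) = - (if (bump 0 k <= j)%N then -1 else 1) :> C.
  by rewrite if_same; case: eqP => // _; case: leqP => _; ring.
rewrite /bump /= !add1n; have [||/val_inj] := ltngtP j k; rewrite ?opprK //.
by move/eqP; rewrite (negbTE neq).
Qed.

Lemma anticommutator_qq j k :
  q R j *m q R k + q R k *m q R j = (if j == k then 2 else 0)%:M.
Proof.
rewrite !qE anticommutator_flip_op -operator_of_scalar.
apply: eq_operator_of => tau sigma; rewrite !sign_flip_left /= !sqr_i_mul.
have [<-|neq] := eqVneq j k.
  by rewrite flip_leftK leqnn !mulN1r !mulNr sign_sqr opprK -natr1.
suff -> : (if (j <= k)%N then -1 else 1) = - (if (k <= j)%N then -1 else 1) :> C.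
  by rewrite if_same; case: eqP => // _; case: leqP => _; ring.
have [||/val_inj] := ltngtP j k; rewrite ?opprK //.
by move/eqP; rewrite (negbTE neq).
Qed.

Lemma anticommutator_pq j k : p R j *m q R k + q R k *m p R j = 0%:M.
Proof.
rewrite pE qE -operator_of_scalar anticommutator_flip_op.
apply: eq_operator_of => tau sigma; rewrite !sign_flip_left /=.
(* The flip at k reverses [rsite j] iff j < k, and the flip at j reverses [lsite k] iff k <= j:
   exactly one holds, even for j = k. *)
suff -> : (if (bump 0 j <= k)%N then -1 else 1) = - (if (k <= j)%N then -1 else 1) :> C.
  by rewrite if_same; case: eqP => // _; case: leqP => _; ring.
by rewrite /bump /= add1n; case: ltnP; rewrite ?opprK.
Qed.

End Operators.

(** * The span of the p_k and q_k, and the operators whose conjugation preserves it *)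

Section Fermionic.
Local Open Scope complex_scope.
Variables (R : realType) (a b : int).
Local Notation C := R[i].
Local Notation sites := 'I_(width a b).+1.
Local Notation cols := 'I_(width a b).
Implicit Types (j k : cols) (sigma tau rho : conf a b) (u v : operator R a b).

Definition fermionic u : Prop :=
  exists x y : cols -> C, u = \sum_j (x j *: p R j + y j *: q R j).

Lemma fermionicZ z u : fermionic u -> fermionic (z *: u).
Proof.
move=> [x [y ->]]; exists (fun j => z * x j), (fun j => z * y j).
by rewrite scaler_sumr; apply: eq_bigr => j _; rewrite scalerDr !scalerA.
Qed.

Lemma fermionicD u v : fermionic u -> fermionic v -> fermionic (u + v).
Proof.
move=> [x [y ->]] [x' [y' ->]]; exists (fun j => x j + x' j), (fun j => y j + y' j).
by rewrite -big_split; apply: eq_bigr => j _; rewrite /= addrACA !scalerDl.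
Qed.

Lemma fermionic_p j : fermionic (p R j).
Proof.
exists (fun k => (k == j)%:R), (fun=> 0); rewrite (bigD1 j) //= eqxx scale1r scale0r addr0.
by rewrite big1 ?addr0 // => k /negbTE ->; rewrite !scale0r addr0.
Qed.

Lemma fermionic_q j : fermionic (q R j).
Proof.
exists (fun=> 0), (fun k => (k == j)%:R); rewrite (bigD1 j) //= eqxx scale1r scale0r add0r.
by rewrite big1 ?addr0 // => k /negbTE ->; rewrite !scale0r addr0.
Qed.

Lemma fermionic0 : fermionic 0.
Proof. by exists (fun=> 0), (fun=> 0); rewrite big1 // => j _; rewrite !scale0r addr0. Qed.

Lemma fermionic_ind (P : operator R a b -> Prop) :
  P 0 -> (forall u v, P u -> P v -> P (u + v)) -> (forall z u, P u -> P (z *: u)) ->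
  (forall j, P (p R j)) -> (forall j, P (q R j)) ->
  forall u, fermionic u -> P u.
Proof.
move=> P0 PD PZ Pp Pq _ [x [y ->]].
by apply: (big_ind P) => // j _; apply: PD; apply: PZ.
Qed.

Lemma fermionic_tr u : fermionic u -> fermionic u^T.
Proof.
elim/fermionic_ind: u / => [|u v|z u|j|j].
- by rewrite trmx0; apply: fermionic0.
- by rewrite linearD; apply: fermionicD.
- by rewrite linearZ; apply: fermionicZ.
- by rewrite tr_p; apply: fermionic_p.
- by rewrite tr_q -scaleN1r; apply/fermionicZ/fermionic_q.
Qed.

Lemma fermionic_anticommutator u v :
  fermionic u -> fermionic v -> exists x, u *m v + v *m u = x%:M.
Proof.
have anti_gen (w : operator R a b) :
    (forall j, exists x, w *m p R j + p R j *m w = x%:M) ->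
    (forall j, exists x, w *m q R j + q R j *m w = x%:M) ->
    forall t, fermionic t -> exists x, w *m t + t *m w = x%:M.
  move=> wp wq t; elim/fermionic_ind: t / => // [|t t' [x tx] [x' tx']|z t [x tx]].
  - by exists 0; rewrite mulmx0 mul0mx addr0 raddf0.
  - by exists (x + x'); rewrite mulmxDl mulmxDr addrACA tx tx' raddfD.
  - by exists (z * x); rewrite -scalemxAr -scalemxAl -scalerDr tx scale_scalar_mx.
move=> fu fv; apply: (anti_gen) fv => j.
  have [k|k|x] := anti_gen (p R j) _ _ u fu; last by exists x; rewrite addrC.
    by rewrite anticommutator_pp; eexists.
  by rewrite anticommutator_pq; eexists.
have [k|k|x] := anti_gen (q R j) _ _ u fu; last by exists x; rewrite addrC.
  by rewrite addrC anticommutator_pq; eexists.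
by rewrite anticommutator_qq; eexists.
Qed.

(** Invariance of the fermionic space under conjugation by [T], written without the inverse so that
    it composes directly under products. *)
Definition intertwines (T : operator R a b) : Prop :=
  forall u, fermionic u -> exists2 u', fermionic u' & u *m T = T *m u'.

Lemma intertwines_generators T :
  (forall j, exists2 u, fermionic u & p R j *m T = T *m u) ->
  (forall j, exists2 u, fermionic u & q R j *m T = T *m u) -> intertwines T.
Proof.
move=> Tp Tq u; elim/fermionic_ind: u / => // [|u v [u' fu' uT] [v' fv' vT]|z u [u' fu' uT]].
- by exists 0; [exact: fermionic0 | rewrite mulmx0 mul0mx].
- by exists (u' + v'); [exact: fermionicD | rewrite mulmxDl uT vT mulmxDr].
- by exists (z *: u'); [exact: fermionicZ | rewrite -scalemxAl uT scalemxAr].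
Qed.

Lemma intertwinesM T T' : intertwines T -> intertwines T' -> intertwines (T *m T').
Proof.
move=> iT iT' u /iT[u' /iT'[u'' fu'' u'T] uT]; exists u'' => //.
by rewrite mulmxA uT -mulmxA u'T mulmxA.
Qed.

End Fermionic.

(** * The transfer matrix *)

Section TransferMatrix.
Local Open Scope complex_scope.
Variables (R : realType) (a b : int) (beta : R).
Hypothesis beta_gt0 : 0 < beta.
Local Notation C := R[i].
Local Notation sites := 'I_(width a b).+1.
Local Notation cols := 'I_(width a b).
Local Notation Vv := (Vv a b beta).
Local Notation Vh_half := (Vh_half a b beta).
Local Notation V := (V a b beta).
Implicit Types (j k : cols) (sigma tau rho : conf a b) (u v : operator R a b).

Let E : C := (expR beta)%:C.

Let E_neq0 : E != 0.
Proof. by rewrite fmorph_eq0 gt_eqF ?expR_gt0. Qed.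

(** Positivity of beta gives E > 1. Up to a power of E, this is the denominator E^2 - E^-2 of the
    inverse of [Vv] and of the commutation constants. *)
Let E4_neq1 : (E * E) ^+ 2 - 1 != 0.
Proof.
rewrite -!rmorphM -rmorphXn -(rmorph1 (real_complex R)) -rmorphB fmorph_eq0.
have E_gt1 : 1 < expR beta by rewrite expR_gt1.
by rewrite subr_eq0 gt_eqF // exprn_egt1 // mulr_egt1.
Qed.

Lemma expR_sign (s t : bool) :
  (expR (beta * ((if s then 1 else -1) * (if t then 1 else -1))))%:C
  = if s == t then E else E^-1 :> C.
Proof.
by case: s t => -[]; rewrite /= ?mulrNN ?mul1r ?mulr1 ?mulrN ?mulr1 ?expRN ?fmorphV.
Qed.

Definition boundary_site (i : sites) := (i == ord0) || (i == ord_max).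

(** One-site factor of [Vv]; the zero at a boundary site encodes the constraint that the boundary
    spins agree. *)
Definition weight (i : sites) (s t : bool) : C :=
  if s == t then E else if boundary_site i then 0 else E^-1.

Lemma weightN i s t : weight i (~~ s) t = weight i s (~~ t).
Proof. by case: s t => -[]. Qed.

Definition product_op (f : sites -> bool -> bool -> C) : operator R a b :=
  operator_of (fun sigma rho => \prod_i f i (sigma i) (rho i)).

Lemma product_opM f g :
  product_op f *m product_op g =
  product_op (fun i s t => \sum_r f i s r * g i r t).
Proof.
rewrite operator_ofM; apply: eq_operator_of => sigma rho.
rewrite bigA_distr_bigA; apply: eq_bigr => tau _.
by rewrite big_split.
Qed.

Lemma VvE : Vv = product_op weight.
Proof.
apply: eq_operator_of => sigma rho; rewrite mulr_sumr expR_sum rmorph_prod /=.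
case: ifPn => [/andP[/eqP s0 /eqP sm]|].
  apply: eq_bigr => i _; rewrite /spin expR_sign /weight; case: eqP => // neq.
  by case: ifP => // /orP[] /eqP iE; case: neq; rewrite iE.
rewrite negb_and => /orP[] neq.
  by rewrite (bigD1 ord0) //= /weight (negbTE neq) /boundary_site eqxx mul0r.
by rewrite (bigD1 ord_max) //= /weight (negbTE neq) /boundary_site eqxx orbT mul0r.
Qed.

Lemma Vv_unit : Vv \in unitmx.
Proof.
(* [g] inverts [weight] site by site: the 2 by 2 block has determinant E^2 - E^-2 at an interior
   site and is E times the identity at a boundary site. *)
pose g i (s t : bool) : C := if boundary_site i then (if s == t then E^-1 else 0)
  else (if s == t then E else - E^-1) / (E ^+ 2 - E ^- 2).
suff VvK : Vv *m product_op g = 1%:M by case: (mulmx1_unit VvK).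
rewrite VvE product_opM -operator_of_scalar; apply: eq_operator_of => sigma rho.
transitivity (\prod_i (if sigma i == rho i then 1 else 0 : C)).
  apply: eq_bigr => i _; rewrite big_bool /weight /g /=.
  case: (sigma i) (rho i) => -[] /=; case: ifP => _;
    rewrite ?mulr0 ?mul0r ?addr0 ?add0r ?divff //; field;
    by apply/andP; split; [exact: E_neq0 | exact: E4_neq1].
case: eqP => [->|neq]; first by rewrite big1 // => i _; rewrite eqxx.
have [i neq_i] : exists i, sigma i != rho i.
  apply/existsP; apply: contra_notT neq; rewrite negb_exists => /forallP eqs.
  by apply/ffunP => i; apply/eqP; have := eqs i; rewrite negbK.
by rewrite (bigD1 i) //= (negbTE neq_i) mul0r.
Qed.

(* The constants are c = coth (2 beta) and d = - 1 / sinh (2 beta). *)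
Lemma local_commutation : exists c d : C, forall (i : sites) (s t : bool),
  ~~ boundary_site i ->
  sign R s * weight i s t = sign R t * (c * weight i s t + d * weight i s (~~ t)).
Proof.
exists ((E ^+ 2 + E ^- 2) / (E ^+ 2 - E ^- 2)), (- 2 / (E ^+ 2 - E ^- 2)).
move=> i s t /negbTE nb; rewrite /weight nb /sign.
by case: s t => -[] /=; field; apply/andP; split; by [exact: E_neq0 | exact: E4_neq1].
Qed.

Lemma boundary_commutation (i : sites) (s t : bool) : boundary_site i ->
  sign R s * weight i s t = sign R t * weight i s t.
Proof. by rewrite /weight => ->; case: eqP => [->|_]; rewrite ?mulr0. Qed.

(** [weight] only sees whether its two spins agree, so a flip can be carried across [Vv]. *)
Lemma Vv_flip_left j sigma rho :
  \prod_i weight i (flip_left j sigma i) (rho i) =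
  \prod_i weight i (sigma i) (flip_left j rho i).
Proof. by apply: eq_bigr => i _; rewrite !ffunE; case: ifP => // _; apply: weightN. Qed.

Lemma sites_adjacent j k : k = j.+1 :> nat -> rsite j = lsite k.
Proof. by move=> kj; apply: val_inj; rewrite /= kj. Qed.

Lemma flip_left_adjacent j k sigma : k = j.+1 :> nat ->
  flip_left k sigma (lsite k) = ~~ flip_left j sigma (lsite k).
Proof. by move=> kj; rewrite !ffunE /= kj leqnn ltnn. Qed.

(** The flips at j and k = j+1 differ only at the site [lsite k]. *)
Lemma prod_adjacent j k sigma rho : k = j.+1 :> nat ->
  \prod_(i | i != lsite k) weight i (sigma i) (flip_left k rho i) =
  \prod_(i | i != lsite k) weight i (sigma i) (flip_left j rho i).
Proof.
move=> kj; apply: eq_bigr => i; rewrite -val_eqE /= => ik.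
by rewrite !ffunE leq_eqVlt (negbTE ik) /= kj ltnS.
Qed.

Lemma lsite_interior j k : k = j.+1 :> nat -> ~~ boundary_site (lsite k).
Proof.
move=> kj; rewrite negb_or -!val_eqE /= kj /=.
by rewrite -kj ltn_eqF.
Qed.

(** Once the flip is carried across, the spin in p_j or q_j meets only the weight of its own site.
    At an interior site [local_commutation] yields an extra term with that spin reversed, which
    turns the flip into the neighbouring one: p_j mixes with q_{j+1}, and q_j with p_{j-1}. At a
    boundary site the spin passes unchanged. *)
Lemma Vv_intertwines : intertwines Vv.
Proof.
have [c [d cd]] := local_commutation.
apply: intertwines_generators => j.
  have [jw|jw] := ltnP j.+1 (width a b).
    have [k kj] : exists k : cols, k = j.+1 :> nat by exists (Ordinal jw).
    exists (c *: p R j + (d / 'i) *: q R k).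
      by apply: fermionicD; apply: fermionicZ; [exact: fermionic_p | exact: fermionic_q].
    rewrite mulmxDr -!scalemxAr VvE pE qE flip_op_mul !mul_flip_op !operator_ofZ.
    rewrite operator_ofD; apply: eq_operator_of => sigma rho.
    rewrite Vv_flip_left (sites_adjacent kj) sign_flip_left /= kj ltnn mul1r.
    rewrite (bigD1 (lsite k)) //=.
    rewrite [X in _ + _ * (X * _)](bigD1 (lsite k)) //= (prod_adjacent _ _ kj).
    rewrite (flip_left_adjacent _ kj).
    have -> : rho (lsite k) = flip_left j rho (lsite k) by rewrite ffunE /= kj ltnn.
    rewrite [LHS]mulrA cd ?(lsite_interior kj) //.
    by field; exact: neq0Ci.
  exists (p R j); first exact: fermionic_p.
  rewrite VvE pE flip_op_mul mul_flip_op; apply: eq_operator_of => sigma rho.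
  have jm : rsite j = ord_max.
    by apply: val_inj; apply/eqP; rewrite /= /bump /= add1n eqn_leq ltn_ord.
  rewrite Vv_flip_left sign_flip_left ltnn mul1r (bigD1 (rsite j)) //=.
  rewrite mulrA boundary_commutation ?ffunE /= ?ltnn; first by rewrite -mulrA mulrC.
  by rewrite /boundary_site jm eqxx orbT.
have [jw|jw] := posnP j.
  exists (q R j); first exact: fermionic_q.
  rewrite VvE qE flip_op_mul mul_flip_op; apply: eq_operator_of => sigma rho.
  have j0 : lsite j = ord0 by apply: val_inj.
  rewrite Vv_flip_left sign_flip_left leqnn (bigD1 (lsite j)) //=.
  rewrite -!mulrA [sign R _ * (_ * _)]mulrA boundary_commutation ?ffunE /= ?leqnn.
    by rewrite signN; ring.
  by rewrite /boundary_site j0 eqxx.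
have jw' : (j.-1 < width a b)%N by rewrite (leq_ltn_trans (leq_pred j)).
have [k kj] : exists k : cols, j = k.+1 :> nat by exists (Ordinal jw'); rewrite /= prednK.
exists (c *: q R j + ('i * d) *: p R k).
  by apply: fermionicD; apply: fermionicZ; [exact: fermionic_q | exact: fermionic_p].
rewrite mulmxDr -!scalemxAr VvE pE qE flip_op_mul !mul_flip_op !operator_ofZ.
rewrite operator_ofD; apply: eq_operator_of => sigma rho.
rewrite Vv_flip_left (sites_adjacent kj) sign_flip_left leqnn.
rewrite (bigD1 (lsite j)) //=.
rewrite [X in _ + _ * (X * _)](bigD1 (lsite j)) //= -(prod_adjacent _ _ kj).
have rho_j : rho (lsite j) = ~~ flip_left j rho (lsite j).
  by rewrite ffunE /= leqnn negbK.
rewrite rho_j signN.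
have -> : flip_left k rho (lsite j) = ~~ flip_left j rho (lsite j).
  by rewrite (flip_left_adjacent _ kj) negbK.
set P := \prod_(i | _) _.
(* The minus sign is there because [flip_left j] reverses [lsite j]; the bracket is the product to
   which [cd] applies. *)
transitivity (- 'i * (sign R (sigma (lsite j)) *
  weight (lsite j) (sigma (lsite j)) (flip_left j rho (lsite j))) * P); first by ring.
by rewrite cd ?(lsite_interior kj) //; ring.
Qed.

Definition horizontal_weight (gamma : R) sigma : C :=
  (expR (gamma / 2 * \sum_j spin R sigma (lsite j) * spin R sigma (rsite j)))%:C.

Lemma Vh_half_unit : Vh_half \in unitmx.
Proof.
suff VhK : Vh_half *m operator_of (fun sigma rho =>
    if sigma == rho then horizontal_weight (- beta) sigma else 0) = 1%:M.
  by case: (mulmx1_unit VhK).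
rewrite operator_ofM -operator_of_scalar; apply: eq_operator_of => sigma rho.
rewrite (bigD1 sigma) //= eqxx [X in _ + X]big1 => [|tau]; last first.
  by rewrite eq_sym => /negbTE ->; rewrite mul0r.
rewrite addr0; case: eqP => _; last by rewrite mulr0.
by rewrite -rmorphM /= -expRD -mulrDl -mulrDl subrr !mul0r expR0.
Qed.

(** All spins up to [lsite j] are reversed together, so only the product of the two spins beside
    column j changes sign; at coupling beta/2 this gives a factor e^beta or e^-beta. *)
Lemma horizontal_weight_flip j sigma :
  horizontal_weight beta sigma =
  (if sigma (lsite j) == sigma (rsite j) then E else E^-1) *
  horizontal_weight beta (flip_left j sigma).
Proof.
rewrite /horizontal_weight -expR_sign -rmorphM /= -expRD; congr (expR _)%:C.
rewrite (bigD1 j) //= [in RHS](bigD1 j) //=.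
rewrite {1 2 5 6}/spin !ffunE /= leqnn ltnn.
rewrite [in RHS](eq_bigr (fun k => spin R sigma (lsite k) * spin R sigma (rsite k))).
  by case: (sigma _) (sigma _) => -[] /=; field.
move=> k kj; rewrite /spin !ffunE /= /bump /= add1n.
have [_|_|/val_inj kj'] := ltngtP k j; last by rewrite kj' eqxx in kj.
  by case: (sigma _) (sigma _) => -[] /=; rewrite ?mulrNN ?mulrN ?mulNr.
by [].
Qed.

Lemma Vh_half_intertwines : intertwines Vh_half.
Proof.
have comm j f g (c d : C) : (forall sigma,
    f sigma * (if sigma (lsite j) == sigma (rsite j) then E else E^-1)
    = c * f sigma + d * g sigma) ->
    flip_op j f *m Vh_half = Vh_half *m (c *: flip_op j f + d *: flip_op j g).
  move=> cd; rewrite mulmxDr -!scalemxAr flip_op_mul !mul_flip_op !operator_ofZ.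
  rewrite operator_ofD; apply: eq_operator_of => sigma rho.
  rewrite flip_left_eq; case: eqP => [->|_]; last by rewrite !(mulr0, mul0r) addr0.
  rewrite flip_leftK -/(horizontal_weight beta rho).
  rewrite -/(horizontal_weight beta (flip_left j rho)) (horizontal_weight_flip j rho).
  by rewrite mulrA cd; ring.
(* These are cosh beta and sinh beta. For the spins s, t beside column j, exp(beta s t) = cosh beta
   + s t sinh beta, and multiplying by one spin leaves the other in the second term. *)
pose c := (E + E^-1) / 2; pose d := (E - E^-1) / 2.
apply: intertwines_generators => j.
  exists (c *: p R j + (- 'i * d) *: q R j).
    by apply: fermionicD; apply: fermionicZ; [exact: fermionic_p | exact: fermionic_q].
  rewrite pE qE; apply: comm => sigma.
  rewrite [_ * ('i * _)]mulrACA mulNr -expr2 sqrCi opprK mul1r /c /d.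
  by case: (sigma _) (sigma _) => -[] /=; field; exact: E_neq0.
exists (c *: q R j + ('i * d) *: p R j).
  by apply: fermionicD; apply: fermionicZ; [exact: fermionic_q | exact: fermionic_p].
rewrite pE qE; apply: comm => sigma; rewrite /c /d.
by case: (sigma _) (sigma _) => -[] /=; field; exact: E_neq0.
Qed.

Lemma V_unit : V \in unitmx.
Proof. by rewrite !unitmx_mul Vh_half_unit Vv_unit. Qed.

Lemma V_intertwines : intertwines V.
Proof. by do !apply: intertwinesM; (exact: Vh_half_intertwines || exact: Vv_intertwines). Qed.

Lemma VpowS y : Vpow a b beta y.+1 = V *m Vpow a b beta y.
Proof. exact: exprS. Qed.

Lemma VpowSr y : Vpow a b beta y.+1 = Vpow a b beta y *m V.
Proof. exact: exprSr. Qed.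

Lemma Vpow_unit y : Vpow a b beta y \in unitmx.
Proof.
elim: y => [|y IHy]; first exact: unitmx1.
by rewrite VpowS unitmx_mul V_unit.
Qed.

Lemma Vpow_intertwines y : intertwines (Vpow a b beta y).
Proof.
elim: y => [|y IHy]; last by rewrite VpowS; apply: intertwinesM V_intertwines IHy.
by move=> u fu; exists u; rewrite // /Vpow expr0 mulmx1 mul1mx.
Qed.

Lemma tr_V : V^T = V.
Proof.
rewrite !trmx_mul !operator_of_tr mulmxA; congr (_ *m _ *m _); apply: eq_operator_of => sigma rho.
- by rewrite eq_sym; case: eqP => // ->.
- by rewrite [rho _ == _]eq_sym [rho ord_max == _]eq_sym; under eq_bigr do rewrite mulrC.
- by rewrite eq_sym; case: eqP => // ->.
Qed.

Lemma tr_Vpow y : (Vpow a b beta y)^T = Vpow a b beta y.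
Proof.
elim: y => [|y IHy]; first exact: trmx1.
by rewrite VpowS trmx_mul IHy tr_V -VpowSr VpowS.
Qed.

(** [Vv] has zero entries, so strict positivity is asked only on the diagonal; this survives
    products and makes the denominator of the correlations nonzero. *)
Definition positive_op u : Prop :=
  (forall i i', 0 <= u i i') /\ (forall i, 0 < u i i).

Lemma positive_opM u v : positive_op u -> positive_op v -> positive_op (u *m v).
Proof.
move=> [u0 u1] [v0 v1]; split=> [i i'|i]; rewrite mxE.
  by apply: sumr_ge0 => k _; apply: mulr_ge0.
rewrite (bigD1 i) //= ltr_wpDr ?mulr_gt0 //.
by apply: sumr_ge0 => k _; apply: mulr_ge0.
Qed.

Lemma positive_op_of (F : conf a b -> conf a b -> C) :
  (forall sigma rho, 0 <= F sigma rho) -> (forall sigma, 0 < F sigma sigma) ->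
  positive_op (operator_of F).
Proof. by move=> F0 F1; split=> [i j|i]; rewrite mxE. Qed.

Lemma V_positive : positive_op V.
Proof.
have Vh_positive : positive_op Vh_half.
  apply: positive_op_of => [sigma rho|sigma]; last by rewrite eqxx ltcR expR_gt0.
  by case: eqP => // _; rewrite lecR expR_ge0.
do !apply: positive_opM => //.
apply: positive_op_of => [sigma rho|sigma]; last by rewrite !eqxx ltcR expR_gt0.
by case: ifP => // _; rewrite lecR expR_ge0.
Qed.

Lemma Vpow_positive y : positive_op (Vpow a b beta y).
Proof.
elim: y => [|y IHy]; last by rewrite VpowS; apply: positive_opM V_positive IHy.
by split=> [i j|i]; rewrite mxE ?eqxx ?ltr01 // mulrb; case: eqP => _; rewrite ?ler01.
Qed.

End TransferMatrix.

(** * Creation and annihilation parts *)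

Section Vacuum.
Local Open Scope complex_scope.
Variables (R : realType) (a b : int) (N : nat) (beta : R).
Hypothesis beta_gt0 : 0 < beta.
Local Notation C := R[i].
Local Notation cols := 'I_(width a b).
Local Notation VN := (Vpow a b beta N).
Implicit Types (j k : cols) (u : operator R a b).

Let e := basis_vector R (all_plus a b).
Let l := e^T *m VN.

Lemma vacuum_neq0 : (l *m e) 0 0 != 0.
Proof.
rewrite /l /e /basis_vector -colE mxE trmx_delta -rowE mxE.
by have [_ /(_ (enum_rank (all_plus a b)))/lt0r_neq0] := Vpow_positive a b beta N.
Qed.

Definition annihilator j : operator R a b := q R j - 'i *: p R j.

Lemma fermionic_annihilator j : fermionic (annihilator j).
Proof.
rewrite /annihilator -scaleNr; apply: fermionicD; first exact: fermionic_q.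
exact/fermionicZ/fermionic_p.
Qed.

Lemma p_vacuum j : p R j *m e = basis_vector R (flip_left j (all_plus a b)).
Proof. by rewrite pE flip_op_basis ffunE scale1r. Qed.

Lemma q_vacuum j : q R j *m e = 'i *: basis_vector R (flip_left j (all_plus a b)).
Proof. by rewrite qE flip_op_basis ffunE mulr1. Qed.

Lemma annihilatorP j : annihilator j *m e = 0.
Proof. by rewrite mulmxBl -scalemxAl p_vacuum q_vacuum subrr. Qed.

Lemma anticommutator_annihilator j k :
  annihilator j *m q R k + q R k *m annihilator j = (if j == k then 2 else 0)%:M.
Proof.
rewrite mulmxBl mulmxBr addrACA -opprD anticommutator_qq -scalemxAl -scalemxAr.
by rewrite -scalerDr anticommutator_pq scale_scalar_mx mulr0 raddf0 subr0.
Qed.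

Definition excited_bra k : 'rV[C]_#|{: conf a b}| :=
  (basis_vector R (flip_left k (all_plus a b)))^T *m VN.

(** The transpose of l u is u^T V^N e. As u^T is fermionic it passes across V^N, and the resulting
    u' maps e to a combination of its single left flips. *)
Lemma bra_fermionic u : fermionic u ->
  exists y : 'rV[C]_(width a b), l *m u = \sum_k y 0 k *: excited_bra k.
Proof.
move=> /fermionic_tr/(@Vpow_intertwines _ _ _ _ beta_gt0 N)[u' [x [y u'E]] uV].
exists (\row_k (x k + y k * 'i)).
have -> : l *m u = (u' *m e)^T *m VN.
  apply: trmx_inj; rewrite !trmx_mul trmxK tr_Vpow trmxK mulmxA uV.
  by rewrite mulmxA.
rewrite u'E mulmx_suml raddf_sum mulmx_suml /=; apply: eq_bigr => k _.
rewrite mxE mulmxDl -!scalemxAl p_vacuum q_vacuum scalerA -scalerDl.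
have -> (z : C) (v : 'cV_#|{: conf a b}|) : (z *: v)^T = z *: v^T.
  by apply/matrixP => i j; rewrite !mxE.
by rewrite -scalemxAl.
Qed.

(** The matrix is square, with one row per annihilator and one column per excited bra, so a trivial
    kernel will make it invertible. *)
Lemma bra_matrix : exists M : 'M[C]_(width a b),
  forall x : 'rV_(width a b), l *m (\sum_j x 0 j *: annihilator j)
    = \sum_k (x *m M) 0 k *: excited_bra k.
Proof.
have [f fE] := fin_all_exists (fun j => bra_fermionic (fermionic_annihilator j)).
exists (\matrix_(j, k) f j 0 k) => x.
rewrite mulmx_sumr; under eq_bigr => j _ do rewrite -scalemxAr fE scaler_sumr.
rewrite exchange_big; apply: eq_bigr => k _; rewrite mxE scaler_suml.
by apply: eq_bigr => j _; rewrite mxE scalerA.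
Qed.

Lemma bra_annihilator_eq0 (x : 'rV[C]_(width a b)) :
  l *m (\sum_j x 0 j *: annihilator j) = 0 -> x = 0.
Proof.
set w := \sum_j _ => lw0; have we0 : w *m e = 0.
  by rewrite mulmx_suml big1 // => j _; rewrite -scalemxAl annihilatorP scaler0.
apply/rowP => k; rewrite [RHS]mxE.
have anti : w *m q R k + q R k *m w = (x 0 k * 2)%:M.
  rewrite mulmx_suml mulmx_sumr -big_split /= (bigD1 k) //= big1 => [|j jk].
    rewrite addr0 -scalemxAl -scalemxAr -scalerDr anticommutator_annihilator eqxx.
    by rewrite scale_scalar_mx.
  rewrite -scalemxAl -scalemxAr -scalerDr anticommutator_annihilator (negbTE jk).
  by rewrite scale_scalar_mx mulr0 raddf0.
(* Both terms of the anticommutator vanish between l and e, since l w = 0 and w e = 0; the scalar 2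
   x_k must therefore be zero. *)
have : l *m (x 0 k * 2)%:M *m e = 0.
  by rewrite -anti mulmxDr mulmxDl !mulmxA lw0 !mul0mx -[X in _ + X]mulmxA we0 mulmx0 addr0.
rewrite mul_mx_scalar -scalemxAl => /matrixP/(_ 0 0)/eqP.
rewrite [X in X == _]mxE [X in _ == X]mxE.
by rewrite !mulf_eq0 (negbTE vacuum_neq0) pnatr_eq0 !orbF => /eqP.
Qed.

Lemma vacuum_decomposition u : fermionic u ->
  exists d, [/\ fermionic d, d *m e = 0 & l *m (u - d) = 0].
Proof.
have [M ME] := bra_matrix.
have M_unit : M \in unitmx.
  rewrite -row_free_unit; apply: inj_row_free => x xM.
  apply: bra_annihilator_eq0; rewrite ME xM big1 // => k _.
  by rewrite mxE scale0r.
move=> /bra_fermionic[y uy].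
(* The coefficients make l d and l u the same combination of excited bras. *)
exists (\sum_j (y *m invmx M) 0 j *: annihilator j); split.
- apply: (big_ind (@fermionic R a b)) => [|v v'|j _]; first exact: fermionic0.
    exact: fermionicD.
  exact/fermionicZ/fermionic_annihilator.
- by rewrite mulmx_suml big1 // => j _; rewrite -scalemxAl annihilatorP scaler0.
- by rewrite mulmxBr uy ME mulmxKV // subrr.
Qed.

End Vacuum.

(** * Values at the edges *)

Section Edges.
Local Open Scope complex_scope.
Variables (R : realType) (a b : int) (N : nat) (beta : R).
Variables psi psibar : R[i] -> operator R a b.
Hypotheses (a_lt_b : a < b) (beta_gt0 : 0 < beta).
Hypothesis fermion : is_fermion N beta psi psibar.
Local Notation C := R[i].
Local Notation cols := 'I_(width a b).
Implicit Types (j k : cols) (P Q u : operator R a b).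

Lemma half_complex : 1 / 2 = 2^-1 +i* 0 :> C.
Proof.
by rewrite mul1r -[2]/(2%:R) -(rmorph_nat (real_complex R)) -fmorphV.
Qed.

Lemma half_i_complex : 'i / 2 = 0 +i* 2^-1 :> C.
Proof.
rewrite -[2^-1]mul1r half_complex -complexiE.
by apply/eqP; rewrite eq_complex /=; apply/andP; split; apply/eqP; ring.
Qed.

Lemma face_north j (y : 'I_N) :
  face R j y + 'i / 2 = horizontal_edge R j (lift ord0 y).
Proof.
rewrite half_i_complex; apply/eqP; rewrite eq_complex /= /bump /= addr0 eqxx /=.
by apply/eqP; rewrite natrD; field.
Qed.

Lemma face_south j (y : 'I_N) :
  face R j y - 'i / 2 = horizontal_edge R j (widen_ord (leqnSn N) y).
Proof.
rewrite half_i_complex; apply/eqP; rewrite eq_complex /= subr0 eqxx /=.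
by apply/eqP; field.
Qed.

Lemma face_east j (y : 'I_N) : face R j y + 1 / 2 = vertical_edge R (rsite j) y.
Proof.
rewrite half_complex; apply/eqP; rewrite eq_complex /= addr0 eqxx andbT.
by apply/eqP; rewrite /bump /= PoszD !intrD; field.
Qed.

Lemma face_west j (y : 'I_N) : face R j y - 1 / 2 = vertical_edge R (lsite j) y.
Proof.
rewrite half_complex; apply/eqP; rewrite eq_complex /= subr0 eqxx andbT.
by apply/eqP; field.
Qed.

Lemma lambda_neq0 : lambda R != 0.
Proof.
apply/eqP => /eqP; rewrite eq_complex /= => /andP[/eqP c0 /eqP s0].
by have /eqP := cos2Dsin2 (pi / 4 : R); rewrite c0 s0 expr0n addr0 eq_sym oner_eq0.
Qed.

Lemma lambda2 : lambda R ^+ 2 = 'i%R.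
Proof.
have cs : cos (pi / 4) = sin (pi / 4 : R).
  by apply: oppr_inj; rewrite -sinBpihalf -sinN; congr sin; field.
have := cos2Dsin2 (pi / 4 : R); rewrite /lambda cs => s2.
rewrite -complexiE; apply/eqP; rewrite eq_complex expr2 /=.
by rewrite subrr eqxx /= -[_ * _]expr2 s2.
Qed.

Let s : C := (expR (- 2 * beta))%:C.

Let s_sub_i_neq0 : s - 'i != 0.
Proof. by rewrite -complexiE eq_complex /= subr0 gt_eqF // expR_gt0. Qed.

Lemma nu_neq0 : nu beta != 0.
Proof.
have s_add_i_neq0 : s + 'i != 0.
  by rewrite -complexiE eq_complex /= addr0 gt_eqF // expR_gt0.
by rewrite /nu -/s !mulf_neq0 ?invr_eq0 ?expf_neq0 ?lambda_neq0.
Qed.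

(** Equality would give ((s+i)/(s-i))^2 = lambda^8 = 1, whereas (s+i)^2 - (s-i)^2 = 4 s i is
    nonzero. This makes the systems for the vertical edges nondegenerate. *)
Lemma nu2_neq_lambda2 : nu beta ^+ 2 != lambda R ^+ 2.
Proof.
have l8 : lambda R ^+ 8 = 1.
  by rewrite (exprM _ 2 4) lambda2 (exprM _ 2 2) sqrCi sqrrN expr1n.
have s_neq0 : s != 0 by rewrite fmorph_eq0 gt_eqF // expR_gt0.
rewrite /nu -/s; apply/eqP => nu_lambda.
have : (s + 'i) ^+ 2 = (s - 'i) ^+ 2.
  transitivity (lambda R ^+ 6 * (lambda R ^- 3 * ((s + 'i) / (s - 'i))) ^+ 2 * (s - 'i) ^+ 2).
    by field; rewrite lambda_neq0 s_sub_i_neq0.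
  by rewrite nu_lambda -exprD l8 mul1r.
move/eqP; rewrite -subr_eq0 (_ : _ - _ = 4 * s * 'i); last by ring.
by rewrite !mulf_eq0 pnatr_eq0 (negbTE s_neq0) (negbTE (neq0Ci _)).
Qed.

(** Cramer's rule with operators as unknowns. *)
Lemma fermionic_solve P Q u v (x y x' y' : C) :
  u = x *: P + y *: Q -> v = x' *: P + y' *: Q -> x * y' - x' * y != 0 ->
  fermionic u -> fermionic v -> fermionic P /\ fermionic Q.
Proof.
move=> uE vE; set D := _ - _ => D0 fu fv; split.
  have -> : P = (y' / D) *: u + (- y / D) *: v.
    rewrite uE vE !scalerDr !scalerA addrACA -!scalerDl.
    rewrite [X in _ = X *: P + _](_ : _ = 1); last by rewrite /D; field.
    rewrite [X in _ = _ + X *: Q](_ : _ = 0); last by rewrite /D; field.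
    by rewrite scale0r addr0 scale1r.
  by apply: fermionicD; apply: fermionicZ.
have -> : Q = (- x' / D) *: u + (x / D) *: v.
  rewrite uE vE !scalerDr !scalerA addrACA -!scalerDl.
  rewrite [X in _ = X *: P + _](_ : _ = 0); last by rewrite /D; field.
  rewrite [X in _ = _ + X *: Q](_ : _ = 1); last by rewrite /D; field.
  by rewrite scale0r add0r scale1r.
by apply: fermionicD; apply: fermionicZ.
Qed.

Lemma fermionic_horizontal j (y : 'I_N.+1) :
  fermionic (psi (horizontal_edge R j y)) /\ fermionic (psibar (horizontal_edge R j y)).
Proof.
have conj u : fermionic u -> fermionic (invmx (Vpow a b beta y) *m u *m Vpow a b beta y).
  move=> /(@Vpow_intertwines _ _ _ _ beta_gt0 y)[u' fu' uV].
  by rewrite -mulmxA uV mulmxA mulVmx ?Vpow_unit // mul1mx.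
rewrite (psi_horizontal fermion) (psibar_horizontal fermion); split; apply: conj.
  by apply/fermionicZ/fermionicD; [exact: fermionic_p | exact: fermionic_q].
rewrite /psibar0 -scaleN1r; apply/fermionicZ/fermionicD; first exact: fermionic_p.
exact/fermionicZ/fermionic_q.
Qed.

(** The two face relations through the east edge have their other sides on the north and south
    edges, which are horizontal and already known to be fermionic. *)
Lemma fermionic_east j (y : 'I_N) :
  fermionic (psi (vertical_edge R (rsite j) y)) /\
  fermionic (psibar (vertical_edge R (rsite j) y)).
Proof.
have := face_NE fermion j y; have := face_SE fermion j y => /=.
rewrite face_north face_south face_east => SE NE.
have [fN fN'] := fermionic_horizontal j (lift ord0 y).
have [fS fS'] := fermionic_horizontal j (widen_ord (leqnSn N) y).
apply: (fermionic_solve NE SE).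
- have -> : (nu beta)^-1 * lambda R ^+ 3 - nu beta * lambda R =
     - lambda R / nu beta * (nu beta ^+ 2 - lambda R ^+ 2).
    by field; exact: nu_neq0.
  apply: mulf_neq0; last by rewrite subr_eq0 nu2_neq_lambda2.
  by apply: mulf_neq0; rewrite ?oppr_eq0 ?invr_eq0 ?lambda_neq0 ?nu_neq0.
- exact: fermionicD fN (fermionicZ _ fN').
- exact: fermionicD fS (fermionicZ _ fS').
Qed.

Lemma fermionic_west j (y : 'I_N) :
  fermionic (psi (vertical_edge R (lsite j) y)) /\
  fermionic (psibar (vertical_edge R (lsite j) y)).
Proof.
have := face_NW fermion j y; have := face_SW fermion j y => /=.
rewrite face_north face_south face_west => SW NW.
have [fN fN'] := fermionic_horizontal j (lift ord0 y).
have [fS fS'] := fermionic_horizontal j (widen_ord (leqnSn N) y).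
apply: (fermionic_solve NW SW).
- have -> : nu beta / lambda R ^+ 3 - (nu beta)^-1 / lambda R =
     (nu beta)^-1 / lambda R ^+ 3 * (nu beta ^+ 2 - lambda R ^+ 2).
    by field; rewrite nu_neq0 lambda_neq0.
  apply: mulf_neq0; last by rewrite subr_eq0 nu2_neq_lambda2.
  by apply: mulf_neq0; rewrite invr_eq0 ?expf_neq0 ?lambda_neq0 ?nu_neq0.
- exact: fermionicD fN (fermionicZ _ fN').
- exact: fermionicD fS (fermionicZ _ fS').
Qed.

Lemma width_gt0 : (0 < width a b)%N.
Proof. by rewrite absz_gt0 subr_eq0 gt_eqF. Qed.

Lemma fermionic_edge z : is_edge a b N z -> fermionic (psi z) /\ fermionic (psibar z).
Proof.
case=> [[j [y ->]]|[j [y ->]]]; first exact: fermionic_horizontal.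
have [jw|jw] := ltnP j (width a b).
  by have -> : j = lsite (Ordinal jw) by [apply: val_inj]; apply: fermionic_west.
(* The last column of vertical edges has no face to its right; it is the east side of face column j
   - 1, which exists because a < b. *)
have jw' : (j.-1 < width a b)%N by rewrite prednK ?(leq_trans width_gt0) // -ltnS.
have -> : j = rsite (Ordinal jw').
  by apply: val_inj; rewrite /= /bump add1n prednK // (leq_trans width_gt0).
exact: fermionic_east.
Qed.

End Edges.

(** * Wick's formula for the fermions of the box *)

Theorem theorem23 (R : realType) (a b : int) (N : nat) (beta : R)
    (psi psibar : R[i] -> operator R a b)
    (n : nat) (z : 'I_n -> R[i]) (bar : 'I_n -> bool) :
  a < b -> (1 <= N)%N -> 0 < beta ->
  is_fermion N beta psi psibar ->
  (forall i, is_edge a b N (z i)) ->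
  let Psi (i : 'I_n) : operator R a b := if bar i then psibar (z i) else psi (z i) in
  expectation N beta (\prod_(i < n) Psi i)
  = Pf (antisymmetric_mx (fun i j => expectation N beta (Psi i *m Psi j))).
Proof.
move=> a_lt_b _ beta_gt0 fermion z_edge Psi.
have fPsi i : fermionic (Psi i).
  by rewrite /Psi; have [] := fermionic_edge a_lt_b beta_gt0 fermion (z_edge i); case: (bar i).
have [d dP] := fin_all_exists (fun i => vacuum_decomposition N beta_gt0 (fPsi i)).
have fd i : fermionic (d i) by case: (dP i).
have [B BE] := fin_all_exists (fun ij : 'I_n * 'I_n =>
  fermionic_anticommutator (fd ij.1) (fPsi ij.2)).
apply: (wick (vacuum_neq0 a b N beta) (d := d) (B := fun i j => B (i, j))) => [i|i|i j].
- by case: (dP i).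
- by case: (dP i).
- exact: (BE (i, j)).
Qed.
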